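(* The Continuum Hypothesis is equivalent to the non-existence of a dense subset $X\subseteq\mathbb{R}$ of cardinality $|X|<\mathfrak{c}$ which is plastic.
   Context: $\mathfrak{c}=2^{\aleph_0}$ denotes the cardinality of $\mathbb{R}$; the Continuum Hypothesis is the statement $\mathfrak{c}=\omega_1$. The equivalence is asserted in ZFC. For a metric space $(X,d)$, a map $f\colon X\to X$ is non-expansive if $d(f(x),f(y))\leq d(x,y)$ for all $x,y\in X$. A metric space $X$ is plastic if every non-expansive bijection $f\colon X\to X$ is an isometry. A subset of a metric space is plastic if it is plastic as a subspace (with the restricted metric); $\mathbb{R}$ carries the usual metric $|x-y|$. *)

(* Defs.v *)
From HB Require Import structures.
From mathcomp Require Import all_boot all_order all_algebra.
From mathcomp Require Import all_classical all_reals all_analysis.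
From mathcomp Require Import wochoice.

Set Implicit Arguments.
Unset Strict Implicit.
Unset Printing Implicit Defensive.

Import numFieldNormedType.Exports.

Local Open Scope classical_set_scope.
Local Open Scope card_scope.
Local Open Scope ring_scope.

(* The library puts the metric `|y - x| on R^o only; this is the same metric
   on R itself. *)
HB.instance Definition _ (R : realType) := Metric.copy R R^o.

Lemma mdist_realE (R : realType) (x y : R) : mdist x y = `|y - x|.
Proof. by []. Qed.

Section subspace_metric.
Context {R : realType} {M : metricType R} (A : set M).

Let dist (x y : A) : R := mdist (set_val x) (set_val y).

Let dist_ge0 x y : 0 <= dist x y.
Proof. exact: mdist_ge0. Qed.

Let dist_positivity x y : dist x y = 0 -> x = y.
Proof. by move=> /mdist_positivity/val_inj. Qed.

Let ballEdist (x : A) (e : R) : ball x e = [set y | dist x y < e].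
Proof.
have -> : ball x e = set_val @^-1` ball (set_val x) e by [].
by rewrite ballEmdist.
Qed.

HB.instance Definition _ := @PseudoMetric_isMetric.Build R (set_type A)
  dist dist_ge0 dist_positivity ballEdist.

End subspace_metric.

Lemma mdist_subspaceE (R : realType) (M : metricType R) (A : set M) (x y : A) :
  mdist x y = mdist (set_val x) (set_val y).
Proof. by []. Qed.

Definition non_expansive (R : realType) (M : metricType R) (f : M -> M) :=
  forall x y, mdist (f x) (f y) <= mdist x y.

Definition distance_preserving (R : realType) (M : metricType R) (f : M -> M) :=
  forall x y, mdist (f x) (f y) = mdist x y.

(* An isometry is a distance-preserving bijection; bijectivity is already part
   of the hypotheses on f. *)
Definition plastic (R : realType) (M : metricType R) :=
  forall f : M -> M, bijective f -> non_expansive f -> distance_preserving f.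

Definition card_lt (T U : Type) (A : set T) (B : set U) :=
  A #<= B /\ A #!= B.

(* (W, r) has order type omega_1: r is a well-order (in non-strict form), W is
   uncountable, and every proper initial segment, i.e. every smaller ordinal,
   is countable. *)
Definition is_omega1 (W : Type) (r : rel W) :=
  [/\ well_order r,
      ~ countable [set: W] &
      forall x : W, countable [set y | r y x /\ y <> x]].

(* The cardinality of R is omega_1; is_omega1 determines (W, r) up to order
   isomorphism. *)
Definition continuum_hypothesis (R : realType) :=
  exists (W : Type) (r : rel W), is_omega1 r /\ [set: R] #= [set: W].

(* Main.v *)
(* If CH holds, a set of reals of cardinality less than the continuum is
   countable.  On a countable dense set a back-and-forth argument builds an
   increasing bijection all of whose slopes lie strictly between 1/2 and 1.

   If CH fails, take a set Y of aleph_1 reals that contains the rationals and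
   meets every interval in an uncountable set, and remove the irrationals lying
   in a sequence of disjoint gaps, unbounded in both directions, of strictly
   decreasing lengths.  Let K be the complement of the gaps, and extend a
   non-expansive bijection of the remaining set X to a 1-Lipschitz F on the
   line.  Since X is uncountable near every point of K and countable in every
   gap, F maps K into K and takes values in K on both sides of every gap.  So
   some gap must be stretched across any given gap n, and being at least as
   long it has index at most n; by induction F maps every gap onto itself.  No
   gap can be flipped, because the distance to another gap would increase, so F
   fixes all endpoints of gaps, and a non-expansive map of the line fixing
   arbitrarily small and arbitrarily large points is the identity. *)
Require Import Defs.
From mathcomp Require Import all_boot all_order all_algebra.
From mathcomp Require Import all_classical all_reals all_analysis.
From mathcomp Require Import wochoice lra.
Import Order.TTheory GRing.Theory Num.Theory.
Import numFieldNormedType.Exports.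
Local Open Scope classical_set_scope.
Local Open Scope card_scope.
Local Open Scope ring_scope.

(** * Cardinality *)

Lemma countable_setU {T : Type} {A B : set T} :
  countable A -> countable B -> countable (A `|` B).
Proof.
move=> cA cB; rewrite -bigcup2E; apply: bigcup_countable => [|[|[|k]] _] //.
Qed.

Lemma well_order_min {W : Type} {r : rel W} {A : set W} :
  well_order r -> A !=set0 -> exists2 z, A z & forall y, A y -> r z y.
Proof.
move=> wo [a Aa]; have [|z [[zA zmin] _]] := wo [pred x | `[< A x >]].
  by exists a; apply/asboolP.
exists z; first exact/asboolP.
by move=> y Ay; apply: zmin; apply/asboolP.
Qed.

(** Both [x] and [y] are minima of the pair {x, y}, and a well-order has unique minima. *)
Lemma well_order_anti {W : Type} {r : rel W} {x y : W} :
  well_order r -> r x y -> r y x -> x = y.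
Proof.
move=> wo rxy ryx.
have refl z : r z z.
  by have [_ -> min] := well_order_min (A := [set z]) wo (ex_intro _ z erefl); exact: min.
have [|z [_ zuniq]] := wo [pred z | `[< z = x \/ z = y >]].
  by exists x; apply/asboolP; left.
have <- : z = x.
  apply: zuniq; split; first by apply/asboolP; left.
  by move=> t /asboolP[]->.
apply: zuniq; split; first by apply/asboolP; right.
by move=> t /asboolP[]->.
Qed.

Lemma well_order_wf {W : Type} {r : rel W} :
  well_order r -> well_founded (fun y x => r y x /\ y <> x).
Proof.
move=> wo x; apply: contrapT => nAx.
have [z nAz zmin] := well_order_min (A := [set z | ~ Acc _ z]) wo (ex_intro _ x nAx).
apply: nAz; constructor => y [ryz nyz]; apply: contrapT => /zmin rzy.
exact/nyz/(well_order_anti wo).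
Qed.

(** Transfinite recursion along [r]: at stage [w] the values chosen so far are indexed by a
    countable initial segment, so they cannot exhaust [A] and a fresh element remains. *)
Lemma omega1_le_uncountable {T W : Type} {r : rel W} {A : set T} :
  is_omega1 r -> ~ countable A -> [set: W] #<= A.
Proof.
move=> [wo _ seg] Aunc.
pose lt y x := r y x /\ y <> x.
have fresh (w : W) (h : forall v, lt v w -> T) :
    {t : T | A t /\ forall v (vw : lt v w), h v vw <> t}.
  apply: cid; apply: contrapT => none; apply: Aunc.
  (* [h] is defined only on proofs of [lt v w]; the value [None] makes it total, so that the
     countable segment bounds its image. *)
  pose h' v : option T := if pselect (lt v w) is left vw then Some (h v vw) else None.
  have : some @` A `<=` h' @` [set v | lt v w].
    move=> _ [t At <-]; apply: contrapT => nt; apply: none; exists t; split=> // v vw hv.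
    apply: nt; exists v => //; rewrite /h'; case: pselect => // vw'.
    by rewrite (Prop_irrelevance vw' vw) hv.
  move=> /subset_card_le sA; apply: sub_countable (seg w).
  apply: card_le_trans (card_image_le h' _); apply: card_le_trans sA.
  by rewrite (card_le_eqr card_some) card_lexx.
pose g := Fix (well_order_wf wo) (fun _ => T) (fun w h => projT1 (fresh w h)).
have gE w : g w = projT1 (fresh w (fun v _ => g v)).
  rewrite /g Fix_eq // => x f f' ff'; congr (projT1 (fresh _ _)).
  by apply: functional_extensionality_dep => v; apply: functional_extensionality_dep.
have gA w : A (g w) by rewrite gE; have [] := projT2 (fresh w (fun v _ => g v)).
have gN v w : lt v w -> g v <> g w.
  by rewrite [g w]gE => vw; have [_] := projT2 (fresh w (fun v _ => g v)); exact.
have ginj : {in [set: W] &, injective g}.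
  move=> v w _ _ gvw; apply: contrapT => nvw.
  have [z zP zmin] := well_order_min (A := [set z | z = v \/ z = w]) wo
    (ex_intro _ v (or_introl erefl)).
  have [rvw|rwv] : r v w \/ r w v.
    by case: zP zmin => -> zmin; [left|right]; apply: zmin; [right|left].
  - exact: (gN v w _ gvw).
  - by apply: (gN w v _ (esym gvw)); split => // wv; exact: nvw.
apply: card_le_trans (_ : g @` setT #<= A); last by apply: subset_card_le => _ [w _ <-].
by rewrite (card_le_eqr (inj_card_eq ginj)) card_lexx.
Qed.

(** Well-order [T]. Either all initial segments are countable and [T] itself serves, or the least
    uncountable initial segment does. *)
Lemma omega1_ex {T : Type} :
  ~ countable [set: T] -> exists (W : Type) (r : rel W), is_omega1 r.
Proof.
move=> Tunc; have [r wo] := well_ordering_principle {classic T}.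
have [allc|] := pselect (forall x, countable [set y | r y x /\ y <> x]).
  by exists T, r; split.
move=> /existsNP nallc.
have [x xunc xmin] :=
  well_order_min (A := [set x | ~ countable [set y | r y x /\ y <> x]]) wo nallc.
pose S : set T := [set y | r y x /\ y <> x].
exists (set_type S), (fun a b => r (val a) (val b)); split.
- move=> A [a aA].
  have [|z [s [sA sz]] zmin] :=
    well_order_min (A := [set y | exists s : S, s \in A /\ val s = y]) wo.
    by exists (val a), a.
  exists s; split.
    by split=> // b bA; rewrite sz; apply: zmin; exists b.
  move=> s' [s'A s'min]; apply: val_inj; apply: (well_order_anti wo).
  + by rewrite sz; apply: zmin; exists s'.
  + exact: s'min.
- by move=> c; apply: xunc; rewrite -/S -(eq_countable (card_setT S)).
- move=> b; have cb : countable [set y | r y (val b) /\ y <> val b].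
    apply: contrapT => /xmin rxb; have [rbx] := set_valP b; apply.
    exact: (well_order_anti wo).
  apply: sub_countable cb.
  apply: card_le_trans (_ : _ #<= val @` [set y : S | r (val y) (val b) /\ y <> b]) _.
    rewrite (card_le_eqr (inj_card_eq _)) ?card_lexx//.
    by move=> ? ? _ _; exact: val_inj.
  by apply: subset_card_le => _ [y [ryb nyb] <-]; split=> // /val_inj.
Qed.

(* With W * nat again of type omega_1, no proof of aleph_1 * aleph_0 = aleph_1 is needed. *)
Lemma omega1_lex {W : Type} {r : rel W} : is_omega1 r ->
  is_omega1 (fun a b : W * nat =>
    `[< r a.1 b.1 /\ (a.1 = b.1 -> (a.2 <= b.2)%N) >]).
Proof.
move=> [wo Wunc seg]; split.
- move=> A [a aA].
  have [|w [n0 wA] wmin] := well_order_min (A := [set w | exists n, (w, n) \in A]) wo.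
    by exists a.1, a.2; case: a aA.
  have exn : exists n, (w, n) \in A by exists n0.
  case: (ex_minnP exn) => n nA nmin; exists (w, n); split.
    split=> // -[v m] vA; apply/asboolP; split=> /=; first by apply: wmin; exists m.
    by move=> wv; apply: nmin; rewrite wv.
  move=> [v m] [vA vmin].
  have /asboolP/= [rvw le2] := vmin _ nA.
  have wv : v = w by apply: (well_order_anti wo rvw); apply: wmin; exists m.
  rewrite wv; congr (_, _); apply/eqP; rewrite eqn_leq le2// andbT.
  by apply: nmin; rewrite -wv.
- move=> c; apply: Wunc; apply: sub_countable c.
  apply: card_le_trans (card_image_le fst setT); apply: subset_card_le => w _.
  by exists (w, 0%N).
- move=> [w n]; pose S := [set y | r y w /\ y <> w] `|` [set w].
  have cS : countable S by apply: countable_setU (seg w) (countable1 w).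
  have := countableX cS (countableP [set: nat]); apply: sub_countable.
  apply: subset_card_le => -[v m] [/asboolP/= [rvw _] _]; split => //=.
  by have [->|nvw] := pselect (v = w); [right|left].
Qed.

(** Countable sets are Lebesgue null, whereas the unit interval has measure 1. *)
Lemma uncountable_real {R : realType} : ~ countable [set: R].
Proof.
move=> /(sub_countable (card_leT `[0%R : R, 1%R]%classic)) c.
have := countable_lebesgue_measure0 c.
by rewrite lebesgue_measure_itv/= lte01 oppr0 adde0 => /eqP; rewrite onee_eq0.
Qed.

(** * Countable dense sets *)

Lemma seq_argmax {R : realDomainType} {T : eqType} (f : T -> R) {s : seq T} :
  s != [::] -> exists2 v, v \in s & forall u, u \in s -> f u <= f v.
Proof.
elim: s => // x [|y s] IH _.
  by exists x; rewrite ?mem_head// => u; rewrite inE => /eqP->.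
have [//|v vs vmax] := IH; have [xv|vx] := leP (f x) (f v).
  exists v; first by rewrite inE vs orbT.
  by move=> u; rewrite inE => /orP[/eqP->//|/vmax].
exists x; rewrite ?mem_head// => u; rewrite inE => /orP[/eqP->//|/vmax].
by move=> /le_trans; apply; exact: ltW.
Qed.

Lemma dense_between {R : realType} {X : set R} {a b : R} :
  dense X -> a < b -> exists2 x, X x & a < x < b.
Proof.
move=> dX ab; have [||x [/= xab Xx]] := dX `]a, b[%classic.
- by exists ((a + b) / 2); rewrite /= in_itv/= !midf_lt.
- exact: interval_open.
- by exists x => //; move: xab; rewrite in_itv.
Qed.

Definition slope_lt {R : realType} (a b : R) (u v : R * R) :=
  u.1 < v.1 /\ a * (v.1 - u.1) < v.2 - u.2 < b * (v.1 - u.1).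

Definition slopes_in {R : realType} (a b : R) (s : seq (R * R)) :=
  forall u v, u \in s -> v \in s -> [\/ u = v, slope_lt a b u v | slope_lt a b v u].

(** Each earlier pair [u] confines the new value to the interval between the lines through [u] of
    slopes [a] and [b]. The slope bounds on [s] make any two of these intervals overlap, so the
    largest lower end is below the smallest upper end, and density of [X] supplies a value in
    between. *)
Lemma slopes_extend {R : realType} {X : set R} {a b : R} {s} (x : R) :
    dense X -> 0 < a -> a < b -> slopes_in a b s ->
    (forall u, u \in s -> u.1 != x) ->
  exists2 y, X y & slopes_in a b ((x, y) :: s).
Proof.
move=> dX a0 ab sl xs.
pose lo (u : R * R) := u.2 + (if u.1 < x then a else b) * (x - u.1).
pose up (u : R * R) := u.2 + (if u.1 < x then b else a) * (x - u.1).
have [y Xy ylu] : exists2 y, X y & forall u, u \in s -> lo u < y < up u.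
  have [->|sN0] := eqVneq s [::].
    by have [y Xy _] := dense_between dX (ltr01 : 0 < 1 :> R); exists y.
  have [v vs vmax] := seq_argmax lo sN0.
  have [w ws wmax] := seq_argmax (fun u => - up u) sN0.
  have vw : lo v < up w.
    rewrite /lo /up; have := xs _ vs; have := xs _ ws.
    case: (ltgtP w.1 x) => // wx _; case: (ltgtP v.1 x) => // vx _;
      have [vw|[vw1 /andP[vw2 vw3]]|[wv1 /andP[wv2 wv3]]] := sl v w vs ws;
      try subst w; nra.
  have [y Xy /andP[vy yw]] := dense_between dX vw; exists y => // u us.
  by have := vmax _ us; have := wmax _ us; lra.
exists y => //.
have new u : u \in s -> slope_lt a b u (x, y) \/ slope_lt a b (x, y) u.
  move=> us; have := ylu _ us; have := xs _ us; rewrite /lo /up /slope_lt /=.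
  by case: (ltgtP u.1 x) => // ux _ /andP[? ?]; [left|right]; split=> //; lra.
move=> u v; rewrite !inE => /orP[/eqP->|us] /orP[/eqP->|vs].
- by constructor 1.
- by case: (new _ vs) => ?; [constructor 3|constructor 2].
- by case: (new _ us) => ?; [constructor 2|constructor 3].
- exact: sl.
Qed.

Definition swap {T : Type} (u : T * T) := (u.2, u.1).

Lemma slope_lt_swap {R : realType} {a b : R} {u v : R * R} : 0 < a -> 0 < b ->
  slope_lt a b (swap u) (swap v) <-> slope_lt b^-1 a^-1 u v.
Proof.
move=> a0 b0; rewrite /slope_lt /swap /= ![_^-1 * _]mulrC.
rewrite ltr_pdivlMr// ltr_pdivrMr//; split=> -[uv /andP[h1 h2]].
- by split; [nra|apply/andP; split; lra].
- by split; [nra|apply/andP; split; lra].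
Qed.

Lemma slopes_in_swap {R : realType} {a b : R} {s} : 0 < a -> 0 < b ->
  slopes_in a b (map swap s) <-> slopes_in b^-1 a^-1 s.
Proof.
move=> a0 b0; have swapK : involutive (@swap R) by case.
split=> sl u v.
  move=> us vs; have [] := sl _ _ (map_f swap us) (map_f swap vs).
  - by move=> /(can_inj swapK) ->; constructor 1.
  - by move=> /(slope_lt_swap a0 b0); constructor 2.
  - by move=> /(slope_lt_swap a0 b0); constructor 3.
move=> /mapP[{}u us ->] /mapP[{}v vs ->]; have [->|uv|vu] := sl _ _ us vs.
- by constructor 1.
- by constructor 2; apply/slope_lt_swap.
- by constructor 3; apply/slope_lt_swap.
Qed.

Definition partial_map_in {R : realType} (X : set R) (a b : R) (s : seq (R * R)) :=
  slopes_in a b s /\ forall u, u \in s -> X u.1 /\ X u.2.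

Lemma partial_map_forth {R : realType} {X : set R} {a b : R} {s} {x : R} :
    dense X -> 0 < a -> a < b -> partial_map_in X a b s -> X x ->
  exists t, [/\ {subset s <= t}, partial_map_in X a b t & exists y, (x, y) \in t].
Proof.
move=> dX a0 ab [sl sX] Xx.
have [/hasP[[x' y] us /= /eqP xx]|/hasPn xs] := boolP (has (fun u => u.1 == x) s).
  by exists s; split=> //; exists y; rewrite -xx.
have [y Xy sly] := slopes_extend x dX a0 ab sl xs.
exists ((x, y) :: s); split; last by exists y; rewrite mem_head.
  by move=> u us; rewrite inE us orbT.
by split=> // u; rewrite inE => /orP[/eqP->|/sX].
Qed.

(** This is the forth step for the inverse partial map, whose slopes lie between [b^-1] and
    [a^-1]. *)
Lemma partial_map_back {R : realType} {X : set R} {a b : R} {s} {y : R} :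
    dense X -> 0 < a -> a < b -> partial_map_in X a b s -> X y ->
  exists t, [/\ {subset s <= t}, partial_map_in X a b t & exists x, (x, y) \in t].
Proof.
move=> dX a0 ab [sl sX] Xy; have b0 := lt_trans a0 ab.
have swapK : involutive (@swap R) by case.
have [|||t [st [slt tX] [x yxt]]] :=
  @partial_map_forth _ X b^-1 a^-1 (map swap s) _ dX _ _ _ Xy.
- by rewrite invr_gt0.
- by rewrite ltf_pV2.
- split; last by move=> _ /mapP[u /sX[? ?] ->].
  by rewrite slopes_in_swap ?invr_gt0// !invrK.
exists (map swap t); split.
- by move=> u us; rewrite -[u]swapK map_f// st// map_f.
- split; last by move=> _ /mapP[u /tX[? ?] ->].
  by apply/slopes_in_swap.
- by exists x; apply/mapP; exists (y, x).
Qed.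

Lemma countable_dense_not_plastic {R : realType} {X : set R} :
  dense X -> countable X -> ~ plastic (set_type X).
Proof.
move=> dX cX pX.
(* The upper slope bound 1 will make the limit map contract distances strictly; the positive lower
   bound will make it injective. *)
have [a [a0 a1]] : exists a : R, 0 < a /\ a < 1 by exists (1 / 2); lra.
have [x0 Xx0 _] := dense_between dX (ltr01 : 0 < 1 :> R).
have [X0|[e]] := pfcard_geP cX; first by rewrite X0 in Xx0.
have Xe n : X (e n) by apply: (@funS _ _ _ _ e).
pose St := {s | partial_map_in X a 1 s}.
have step (s : St) n : {t : St | {subset projT1 s <= projT1 t} /\
    (exists y, (e n, y) \in projT1 t) /\ (exists x, (x, e n) \in projT1 t)}.
  apply: cid; have [t [st Pt [y xyt]]] := partial_map_forth dX a0 a1 (projT2 s) (Xe n).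
  have [t' [tt' Pt' [x yxt']]] := partial_map_back dX a0 a1 Pt (Xe n).
  exists (exist _ t' Pt'); split=> /=; first by move=> u /st/tt'.
  by split; [exists y; exact: tt'|exists x].
have P0 : partial_map_in X a 1 [::] by [].
pose S := fix S n : St := if n is m.+1 then projT1 (step (S m) m) else exist _ [::] P0.
have Smono m n : (m <= n)%N -> {subset projT1 (S m) <= projT1 (S n)}.
  elim: n => [|n IH]; first by rewrite leqn0 => /eqP->.
  rewrite leq_eqVlt => /orP[/eqP->//|/IH sub u /sub us] /=.
  by have [+ _] := projT2 (step (S n) n); exact.
(* [G] is the graph of the limit map; any two of its points already occur together at some finite
   stage. *)
pose G x y := exists n, (x, y) \in projT1 (S n).
have GX x y : G x y -> X x /\ X y by move=> [n /(projT2 (S n)).2].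
have Gsl x y x' y' : G x y -> G x' y' ->
    [\/ (x, y) = (x', y'), slope_lt a 1 (x, y) (x', y') | slope_lt a 1 (x', y') (x, y)].
  move=> [m Gm] [n Gn]; apply: (projT2 (S (maxn m n))).1.
    exact: (Smono _ _ (leq_maxl m n)).
  exact: (Smono _ _ (leq_maxr m n)).
have forth (x : X) : exists y : X, G (val x) (val y).
  have [n _ <-] := (@surj _ _ _ _ e) _ (set_valP x).
  have [_ [[y xy] _]] := projT2 (step (S n) n).
  have Gxy : G (e n) y by exists n.+1.
  by exists (SigSub (mem_set (GX _ _ Gxy).2)).
have back (y : X) : exists x : X, G (val x) (val y).
  have [n _ <-] := (@surj _ _ _ _ e) _ (set_valP y).
  have [_ [_ [x xy]]] := projT2 (step (S n) n).
  have Gxy : G x (e n) by exists n.+1.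
  by exists (SigSub (mem_set (GX _ _ Gxy).1)).
have [f fG] := choice forth; have [g gG] := choice back.
have fbij : bijective f.
  exists g => [x|y]; apply: val_inj.
    by case: (Gsl _ _ _ _ (gG (f x)) (fG x)) => [[]//|[/= lt]|[/= lt]]; nra.
  by case: (Gsl _ _ _ _ (fG (g y)) (gG y)) => [[]//|[/= lt]|[/= lt]]; nra.
have Gcontr x y x' y' : G x y -> G x' y' -> x <> x' -> `|y' - y| < `|x' - x|.
  move=> Gxy Gxy'; case: (Gsl _ _ _ _ Gxy Gxy') => [[]//|[/= lt]|[/= lt]] /andP[h1 h2] _;
    have h0 := mulr_gt0 a0 (etrans (subr_gt0 _ _) lt).
    by rewrite [ltRHS]gtr0_norm ?subr_gt0// ltr_norml; lra.
  by rewrite distrC [ltRHS]ltr0_norm ?subr_lt0// ltr_norml; lra.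
have contr (x y : X) : val x <> val y -> mdist (f x) (f y) < mdist x y.
  exact: Gcontr.
have [x1 Xx1 /andP[x01 _]] := dense_between dX (ltr_pwDr ltr01 (lexx x0)).
have /contr : val (SigSub (mem_set Xx0) : X) <> val (SigSub (mem_set Xx1) : X).
  by move=> /= x01E; rewrite x01E ltxx in x01.
rewrite (pX f fbij) ?ltxx// => x y.
have [->|/eqP xy] := eqVneq x y; first by rewrite !mdistxx.
by apply/ltW/contr => /val_inj.
Qed.

(** * Rigidity of the gaps *)

(** The extension is the infimum over [y] in [X] of the cones [f y + |x - y|]. Each cone is
    1-Lipschitz in [x], hence so is the infimum, and on [X] the cone with apex at [x] attains it. *)
Lemma mcshane {R : realType} {X : set R} {f : R -> R} :
    (forall x y, X x -> X y -> `|f x - f y| <= `|x - y|) ->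
  exists2 F : R -> R, (forall x y, `|F x - F y| <= `|x - y|) &
    forall x, X x -> F x = f x.
Proof.
move=> fX; have [[x0 X0]|X0] := pselect (X !=set0); last first.
  exists (fun=> 0) => [x y|x Xx]; first by rewrite subrr normr0.
  by case: X0; exists x.
pose E x := [set f y + `|x - y| | y in X].
have Enon x : E x !=set0 by exists (f x0 + `|x - x0|), x0.
have Elb x : has_lbound (E x).
  exists (f x0 - `|x - x0|) => _ [y Xy <-].
  have := fX _ _ X0 Xy; have := ler_distD x x0 y; rewrite (distrC x0 x).
  by have := ler_norm (f x0 - f y); lra.
have Einf x y : X y -> inf (E x) <= f y + `|x - y|.
  by move=> Xy; apply: ge_inf => //; exists y.
have half x y : inf (E x) - `|x - y| <= inf (E y).
  apply: lb_le_inf => // _ [z Xz <-].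
  by have := Einf x z Xz; have := ler_distD y x z; lra.
exists (fun x => inf (E x)) => [x y|x Xx].
  by have := half x y; have := half y x; rewrite ler_norml (distrC y x); lra.
apply/eqP; rewrite eq_le; apply/andP; split.
  by have := Einf x x Xx; rewrite subrr normr0 addr0.
apply: lb_le_inf => // _ [y Xy <-].
by have := fX _ _ Xx Xy; have := ler_norm (f x - f y); lra.
Qed.

Definition off_gaps {R : realType} (l r : nat -> R) :=
  [set x | forall k, x <= l k \/ r k <= x].

(** A discrete intermediate value principle: off the gaps [G] never enters []a, b[], so on the way
    from [p] to [q] it must leap over this interval across a single gap. *)
Lemma gap_crossing {R : realType} {l r : nat -> R} {G : R -> R} {a b p q : R} :
    (forall k, off_gaps l r (l k) /\ off_gaps l r (r k)) ->
    (forall x y, `|G x - G y| <= `|x - y|) -> a < b ->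
    (forall x, off_gaps l r x -> G x <= a \/ b <= G x) ->
    off_gaps l r p -> off_gaps l r q -> p < q -> G p <= a -> b <= G q ->
  exists m, G (l m) <= a /\ b <= G (r m).
Proof.
move=> ends lipG ab Gab Kp Kq pq Gp Gq; set K := off_gaps l r in ends Gab Kp Kq.
have lip x y : x <= y -> `|G y - G x| <= y - x.
  by move=> xy; rewrite (le_trans (lipG _ _))// ger0_norm// subr_ge0.
(* The last point t of K before q with [G t <= a] is followed by no points of K
   within distance b - a, so it is the left end of a gap. *)
pose E := [set t | [/\ K t, t <= q & G t <= a]].
have Ep : E p by split=> //; exact: ltW.
have Esup : has_sup E by split; [exists p | exists q => t []].
set t := sup E.
have Et e : E e -> e <= t by move=> Ee; apply: sup_upper_bound.
have near_t e : 0 < e -> exists2 s, E s & t - e < s <= t.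
  by move=> /(sup_adherent)/(_ Esup)[s Es ts]; exists s; rewrite ?ts//= Et.
have tq : t <= q by apply: ge_sup => [|s []//]; exists p.
have Kt : K t.
  move=> k; have [|lt_lk] := leP t (l k); [by left|right].
  have [|s [Ks _ _] /andP[ls st]] := near_t (t - l k); first by rewrite subr_gt0.
  by have [] := Ks k; lra.
have Gt : G t <= a.
  have [//|bG] := Gab _ Kt.
  have [|s [Ks _ Gs] /andP[ls st]] := near_t (b - a); first by rewrite subr_gt0.
  by have := lip _ _ st; rewrite ler_norml; lra.
have above s : K s -> t < s -> s <= q -> b <= G s /\ b - a <= s - t.
  move=> Ks ts sq; have [Gs|bG] := Gab _ Ks.
    by have := Et s (And3 Ks sq Gs); lra.
  by split=> //; have := lip _ _ (ltW ts); rewrite ler_norml; lra.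
have ltq : t < q.
  by rewrite lt_neqAle tq andbT; apply/eqP => tE; move: Gt; rewrite tE; lra.
have [_ dq] := above _ Kq ltq (lexx _).
(* This point lies between [t] and [q], closer to [t] than [b - a], so it cannot be in [K]. *)
have [m [lm rm]] : exists m, l m < t + (b - a) / 2 /\ t + (b - a) / 2 < r m.
  apply: contrapT => nm.
  have Ks : K (t + (b - a) / 2).
    move=> k; apply: contrapT => /not_orP[/negP + /negP]; rewrite -!ltNge => *.
    by apply: nm; exists k.
  by have [] := above _ Ks; lra.
exists m; have [Kl Kr] := ends m.
have tl : t = l m.
  apply/eqP; rewrite eq_le; apply/andP; split; first by have [] := Kt m; lra.
  by rewrite leNgt; apply/negP => tl; have [] := above _ Kl tl; lra.
split; first by rewrite -tl.
by have [] := above _ Kr; [lra|have [] := Kq m; lra|].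
Qed.

Lemma gap_ends {R : realType} {l r : nat -> R} :
    (forall k, l k < r k) ->
    (forall i j, i <> j -> r i <= l j \/ r j <= l i) ->
  forall k, off_gaps l r (l k) /\ off_gaps l r (r k).
Proof.
move=> lr disj k.
split=> j; have [<-|/eqP/disj] := eqVneq j k.
- by left.
- by have := lr j; have := lr k => ? ? [] ?; [right|left]; lra.
- by right.
- by have := lr j; have := lr k => ? ? [] ?; [right|left]; lra.
Qed.

Lemma gaps_rigid {R : realType} {l r : nat -> R} {F : R -> R} :
    (forall k, l k < r k) ->
    (forall i j, i <> j -> r i <= l j \/ r j <= l i) ->
    (forall i j, (i < j)%N -> r j - l j < r i - l i) ->
    (forall x, (exists i, l i <= x) /\ (exists i, x <= l i)) ->
    (forall x y, `|F x - F y| <= `|x - y|) ->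
    (forall x, off_gaps l r x -> off_gaps l r (F x)) ->
    (forall k, (exists2 p, off_gaps l r p & F p <= l k) /\
               (exists2 q, off_gaps l r q & r k <= F q)) ->
  forall x, F x = x.
Proof.
move=> lr disj decr unb lip FK hit.
have ends := gap_ends lr disj.
have gap_fixed n : F (l n) = l n /\ F (r n) = r n \/ F (l n) = r n /\ F (r n) = l n.
  elim/ltn_ind: n => n IH; have lrn := lr n.
  have crossed : exists m, F (l m) <= l n /\ r n <= F (r m) \/
                           F (r m) <= l n /\ r n <= F (l m).
    have [[p Kp Fp] [q Kq Fq]] := hit n.
    have [pq|qp|pq] := ltgtP p q; last by move: Fq; rewrite -pq; lra.
    - have [|m Fm] := gap_crossing ends lip lrn _ Kp Kq pq Fp Fq; last by exists m; left.
      by move=> x /FK.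
    - have [|||||m] := @gap_crossing _ l r (fun x => - F x) (- r n) (- l n) q p
                         ends _ _ _ Kq Kp qp.
      + by move=> x y; rewrite -opprD normrN.
      + lra.
      + by move=> x /FK/(_ n); lra.
      + lra.
      + lra.
      + by move=> Fm; exists m; right; lra.
  have [m Fm] := crossed.
  have := lip (r m) (l m); rewrite [`|r m - _|]gtr0_norm ?subr_gt0// ler_norml => lipm.
  have [mn|nm|mn] := ltngtP m n.
  (* If [m < n], the ends of gap [m] are permuted by induction, so gap [m] would have to cover gap
     [n], against disjointness. If [n < m], gap [m] is too short to be stretched over gap [n]. If
     [m = n], the Lipschitz bound leaves no slack. *)
  - have nmn : m <> n by move=> E; rewrite E ltnn in mn.
    by have := disj _ _ nmn; have := lr m; have := IH m mn; lra.
  - by have := decr _ _ nm; lra.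
  - by rewrite mn in Fm lipm *; lra.
(* A flipped gap would move away from the gap n.+1, which is mapped onto itself. *)
have left_fixed n : F (l n) = l n.
  have [[]//|[Fl Fr]] := gap_fixed n; have lrn := lr n; have lrS := lr n.+1.
  have [/eqP|rl|rl] := disj n n.+1; first by rewrite eqn_leq ltnn andbF.
  - have := lip (l n.+1) (r n); rewrite [`|l _ - _|]ger0_norm ?subr_ge0// ler_norml.
    by have := gap_fixed n.+1; lra.
  - have := lip (l n) (r n.+1); rewrite [`|l _ - _|]ger0_norm ?subr_ge0// ler_norml.
    by have := gap_fixed n.+1; lra.
move=> x; have [[i li] [j lj]] := unb x.
have := lip x (l i); rewrite [`|x - _|]ger0_norm ?subr_ge0// ler_norml left_fixed.
have := lip (l j) x; rewrite [`|l j - _|]ger0_norm ?subr_ge0// ler_norml left_fixed.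
lra.
Qed.

Lemma gaps_plastic {R : realType} {l r : nat -> R} {X : set R} :
    (forall k, l k < r k) ->
    (forall i j, i <> j -> r i <= l j \/ r j <= l i) ->
    (forall i j, (i < j)%N -> r j - l j < r i - l i) ->
    (forall x, (exists i, l i <= x) /\ (exists i, x <= l i)) ->
    (forall k, countable (X `&` [set x | l k < x < r k])) ->
    (forall x e, off_gaps l r x -> 0 < e ->
      ~ countable (X `&` [set y | `|x - y| < e])) ->
  plastic (set_type X).
Proof.
move=> lr disj decr unb ctbl unctbl f fbij fnonexp.
(* The value 0 outside [X] is arbitrary: the extension only looks at [f0] on [X]. *)
pose f0 (x : R) : R := if insub x : option X is Some u then val (f u) else 0.
have f0E (u : X) : f0 (val u) = val (f u) by rewrite /f0 valK.
have Xval x : X x -> exists u : X, val u = x.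
  by move=> Xx; exists (SigSub (mem_set Xx)).
have [|F lip Ff0] := @mcshane R X f0.
  move=> _ _ /Xval[u <-] /Xval[v <-]; rewrite !f0E.
  exact: fnonexp v u.
have FE (u : X) : F (val u) = val (f u) by rewrite Ff0 ?f0E//; exact: set_valP.
have FX x : X x -> X (F x) by move=> /Xval[u <-]; rewrite FE; exact: set_valP.
have Finj (A : set R) : {in X `&` A &, injective F}.
  move=> x y; rewrite !inE => -[/Xval[u <-] _] [/Xval[v <-] _].
  by rewrite !FE => /val_inj/(bij_inj fbij)->.
(* Otherwise a small ball around [x] is mapped into gap [k], and [F] injects its uncountably many
   points of [X] into the countable trace of [X] on that gap. *)
have FK x : off_gaps l r x -> off_gaps l r (F x).
  move=> Kx k; apply: contrapT => /not_orP[/negP + /negP]; rewrite -!ltNge => lF Fr.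
  have [e e0 [el er]] : exists2 e, 0 < e & e <= F x - l k /\ e <= r k - F x.
    exists (Num.min (F x - l k) (r k - F x)); first by rewrite lt_min !subr_gt0 lF.
    by rewrite !ge_min !lexx orbT.
  apply: (unctbl x e Kx e0); apply: sub_countable (ctbl k).
  apply: card_le_trans (_ : _ #<= F @` (X `&` [set y | `|x - y| < e])) _.
    by rewrite (card_le_eqr (inj_card_eq (Finj _))) card_lexx.
  apply: subset_card_le => _ [y [Xy /= xy] <-]; split; first exact: FX.
  by have := lip x y; move: xy => /[swap] /le_lt_trans/[apply]; rewrite ltr_norml /=; lra.
(* Only countably many points of [X] lie in gaps, so their images under the surjection [f] cannot
   exhaust the uncountable set [S]. *)
have hit S : S `<=` X -> ~ countable S -> exists2 p, off_gaps l r p & S (F p).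
  move=> SX Sunc; apply: contrapT => nhit; apply: Sunc.
  have : countable (\bigcup_(k in [set: nat]) (X `&` [set x | l k < x < r k])).
    by apply: bigcup_countable.
  move=> c; apply: sub_countable c; apply: card_le_trans (card_image_le F _).
  apply: subset_card_le => y Sy; have [u uy] := Xval _ (SX _ Sy).
  have [g _ gK] := fbij; exists (val (g u)); last by rewrite FE gK.
  apply: contrapT => nu; apply: nhit; exists (val (g u)); last by rewrite FE gK uy.
  move=> k; apply: contrapT => /not_orP[/negP + /negP]; rewrite -!ltNge => h1 h2.
  by apply: nu; exists k => //; split; [exact: set_valP|rewrite /= h1 h2].
have ends := gap_ends lr disj.
suff Fid : forall x, F x = x.
  have fid u : f u = u by apply: val_inj; rewrite -FE Fid.
  by move=> u v; rewrite !fid.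
apply: (gaps_rigid lr disj decr unb lip FK) => k.
(* A ball of this radius around one end of gap [k] stops at the other end. The gap contributes only
   countably many points of [X] to it, so uncountably many lie beyond the chosen end. *)
have w0 : 0 < r k - l k by rewrite subr_gt0.
have [Kl Kr] := ends k; split.
- have [|c|p Kp [_ Fp]] := hit (X `&` [set x | x <= l k]); last by exists p.
    by move=> x [].
  apply: (unctbl _ _ Kl w0); apply: sub_countable (countable_setU (ctbl k) c).
  apply: subset_card_le => y [Xy /=]; rewrite ltr_norml => /andP[? ?].
  by have [yl|yl] := leP y (l k); [right|left]; split=> //=; lra.
- have [|c|q Kq [_ Fq]] := hit (X `&` [set x | r k <= x]); last by exists q.
    by move=> x [].
  apply: (unctbl _ _ Kr w0); apply: sub_countable (countable_setU (ctbl k) c).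
  apply: subset_card_le => y [Xy /=]; rewrite ltr_norml => /andP[? ?].
  by have [yr|yr] := leP (r k) y; [right|left]; split=> //=; lra.
Qed.

(** * The plastic set *)

(** The centers 0, -1, 2, -3, ... are unbounded in both directions and at mutual distance at least
    1. *)
Definition gap_center {R : realType} (k : nat) : R := (-1) ^+ k * k%:R.
Definition gap_radius {R : realType} (k : nat) : R := (k + 5)%:R^-1.
Definition gap_left {R : realType} (k : nat) : R := gap_center k - gap_radius k.
Definition gap_right {R : realType} (k : nat) : R := gap_center k + gap_radius k.

Lemma gap_radius_lt {R : realType} {i j : nat} :
  (i < j)%N -> gap_radius j < gap_radius i :> R.
Proof.
move=> ij; rewrite /gap_radius ltf_pV2 ?posrE ?ltr0n ?addn_gt0 ?orbT//.
by rewrite ltr_nat ltn_add2r.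
Qed.

Lemma gap_radius_bounds {R : realType} (k : nat) :
  0 < (gap_radius k : R) <= 1 / 5.
Proof.
rewrite /gap_radius invr_gt0 ltr0n addn_gt0 orbT div1r.
rewrite lef_pV2 ?posrE ?ltr0n ?addn_gt0 ?orbT//.
by rewrite ler_nat leq_addl.
Qed.

(** Centers at distance at least 1 and radii at most 1/5 leave 3/5 between two gaps. *)
Lemma gap_separated {R : realType} {i j : nat} : i <> j ->
  gap_right i + 1 / 2 <= gap_left j :> R \/ gap_right j + 1 / 2 <= gap_left i :> R.
Proof.
wlog ij : i j / (i < j)%N.
  move=> wl; have [ij|ji|//] := ltngtP i j => nij; first exact: wl.
  by apply/or_comm/wl => // /esym.
move=> _; have /andP[_ ri] := @gap_radius_bounds R i.
have /andP[_ rj] := @gap_radius_bounds R j.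
have hij : i%:R + 1 <= j%:R :> R by rewrite natr1 ler_nat.
have hi : 0 <= i%:R :> R by rewrite ler0n.
rewrite /gap_left /gap_right /gap_center -(signr_odd _ i) -(signr_odd _ j).
by case: (odd i); case: (odd j); rewrite ?expr1 ?expr0;
  [right|left|right|left]; lra.
Qed.

Lemma gap_left_unbounded {R : realType} (x : R) :
  (exists i, gap_left i <= x) /\ (exists i, x <= gap_left i).
Proof.
have [n xn] : exists n, `|x| + 1 <= n%:R.
  by exists (Num.bound (`|x| + 1)); apply/ltW/archi_boundP; rewrite addr_ge0.
have n2 : n%:R <= n.*2%:R :> R by rewrite ler_nat -addnn leq_addr.
move: xn; have := ler_norm x; have := ler_norm (- x); rewrite normrN => *; split.
- exists n.*2.+1; have /andP[? ?] := @gap_radius_bounds R n.*2.+1.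
  by rewrite /gap_left /gap_center -signr_odd /= odd_double expr1 -natr1; lra.
- exists n.*2; have /andP[? ?] := @gap_radius_bounds R n.*2.
  by rewrite /gap_left /gap_center -signr_odd /= odd_double expr0; lra.
Qed.

(** For [e] at most 1/4, gaps cannot come within [e] of [x] on both sides: a single gap would
    contain [x], and two different gaps would be less than 1/2 apart. So one of the two one-sided
    neighbourhoods avoids all gaps. *)
Lemma off_gaps_near {R : realType} {x e : R} :
    off_gaps gap_left gap_right x -> 0 < e ->
  exists a b, [/\ a < b, x - e <= a, b <= x + e &
    forall y, a < y < b -> off_gaps gap_left gap_right y].
Proof.
move=> Kx e0.
wlog e4 : e e0 / e <= 1 / 4.
  move=> wl; have [/wl|e4] := leP e (1 / 4); first exact.
  have [||a [b [ab xa bx Kab]]] := wl (1 / 4); rewrite ?divr_gt0//.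
  by exists a, b; split=> //; lra.
have [left|/existsNP[y1 /not_implyP[y1x]]] :=
  pselect (forall y, x - e < y < x -> off_gaps gap_left gap_right y).
  by exists (x - e), x; split=> //; lra.
have [right _|/existsNP[y2 /not_implyP[y2x]]] :=
  pselect (forall y, x < y < x + e -> off_gaps gap_left gap_right y).
  by exists x, (x + e); split=> //; lra.
move=> /existsNP[j /not_orP[/negP + /negP]]; rewrite -!ltNge => lj rj.
move=> /existsNP[i /not_orP[/negP + /negP]]; rewrite -!ltNge => li ri.
have := Kx i; have := Kx j.
have [ij|/eqP/(@gap_separated R)] := eqVneq i j; last by lra.
by rewrite ij in li ri *; lra.
Qed.

(** [Y] is the union of countably many affine copies, with rational coefficients, of one bounded set
    of size aleph_1. Scale 0 yields the rationals, and small nonzero scales put an uncountable copy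
    into every interval. *)
Lemma omega1_spread {R : realType} : exists (V : Type) (r : rel V) (Y : set R),
  [/\ is_omega1 r, Y #<= [set: V], range (@ratr R) `<=` Y &
      forall a b, a < b -> ~ countable (Y `&` [set y | a < y < b])].
Proof.
have [W [r Wr]] := omega1_ex (@uncountable_real R).
have /pcard_injP[phi phiI] := omega1_le_uncountable Wr (@uncountable_real R).
have phi_inj w v : phi w = phi v -> w = v by apply: phiI; rewrite in_setT.
have [dec decK] : exists dec : nat -> rat * rat, forall qp, exists n, dec n = qp.
  exists (fun n => odflt (0, 0) (unpickle n)) => qp.
  by exists (pickle qp); rewrite pickleK.
(* [contract] squeezes the line injectively into [-1, 1], so the scale controls the size of each
   copy. *)
pose h (v : W * nat) : R :=
  ratr (dec v.2).1 + ratr (dec v.2).2 * contract (phi v.1)%:E.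
have hE q p : exists n, forall w, h (w, n) = ratr q + ratr p * contract (phi w)%:E.
  by have [n nE] := decK (q, p); exists n => w; rewrite /h /= nE.
have [_ Wunc _] := Wr.
have [w0 _] : [set: W] !=set0.
  by apply/set0P/eqP => W0; apply: Wunc; rewrite W0; exact: countable0.
have [rV rVo] : exists rV : rel (W * nat), is_omega1 rV.
  by eexists; exact: omega1_lex Wr.
exists (W * nat)%type, rV, (range h); split=> //.
- exact: card_image_le.
- move=> _ [q _ <-]; have [n nE] := hE q 0; exists (w0, n) => //.
  by rewrite nE rmorph0 mul0r addr0.
- move=> a b ab c; apply: Wunc.
  (* A copy of W scaled by p < (b - a) / 4 and centred at q fits into ]a, b[. *)
  pose d := (b - a) / 4.
  have d0 : 0 < d by rewrite /d; lra.
  have [q] : exists q : rat, ratr q \in `]a + d, a + d + d[ by apply: rat_in_itvoo; lra.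
  have [p] : exists p : rat, ratr p \in `]0 : R, d[ by apply: rat_in_itvoo.
  rewrite !in_itv /= => /andP[p0 pd] /andP[q0 qd].
  have [n nE] := hE q p; apply: sub_countable c.
  apply: card_le_trans (_ : _ #<= (fun w => h (w, n)) @` setT) _.
    rewrite (card_le_eqr (inj_card_eq _)) ?card_lexx// => w v _ _ /=.
    rewrite !nE => /addrI/(mulfI (lt0r_neq0 p0))/contract_inj[].
    exact: phi_inj.
  apply: subset_card_le => _ [w _ <-]; split; first by exists (w, n).
  rewrite /= nE; have := contract_le1 (phi w)%:E.
  rewrite ler_norml -(ler_pM2l p0) -[in X in _ && X](ler_pM2l p0) mulrN1 mulr1.
  by move=> /andP[c1 c2]; apply/andP; rewrite /d in d0 pd q0 qd; split; lra.
Qed.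

Theorem theorem6 (R : realType) :
  continuum_hypothesis R <->
  ~ (exists X : set R,
       [/\ dense X, card_lt X [set: R] & plastic (set_type X)]).
Proof.
split=> [[W [r [Wr RW]]] [X [dX [XR nXR] pX]]|noX].
  apply: (countable_dense_not_plastic dX _ pX).
  (* An uncountable [X] would have at least omega_1 elements, hence continuum many. *)
  apply: contrapT => /(omega1_le_uncountable Wr) WX.
  case/negP: nXR; rewrite card_eq_le XR /=; apply: card_le_trans WX.
  by rewrite (card_le_eql RW) card_lexx.
have [V [r [Y [Vr YV ratY Yunc]]]] := @omega1_spread R.
pose K := off_gaps (@gap_left R) gap_right.
(* Keeping the rationals inside the gaps preserves density, while [X] stays countable in each
   gap. *)
pose X := Y `&` (K `|` range (@ratr R)).
(* [V] has size aleph_1 and dominates [X]; were it not equinumerous with the line, [X] would have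
   fewer than continuum many points. *)
exists V, r; split=> //; apply: contrapT => nRV; apply: noX; exists X; split.
- move=> O O0 oO; have [x [Ox xq]] := @dense_rat R O O0 oO.
  by exists x; split=> //; split; [exact: ratY|right].
- split; first exact: card_leT.
  apply/negP => XR; apply: nRV; rewrite card_eq_le.
  rewrite (omega1_le_uncountable Vr uncountable_real) andbT.
  apply: card_le_trans YV; apply: (@card_le_trans _ _ _ X); last by apply: subset_card_le => x [].
  by rewrite (card_le_eqr XR) card_lexx.
- apply: (@gaps_plastic R gap_left gap_right).
  + by move=> k; have := @gap_radius_bounds R k; rewrite /gap_left /gap_right; lra.
  + by move=> i j /(@gap_separated R); lra.
  + by move=> i j /(@gap_radius_lt R); rewrite /gap_left /gap_right; lra.
  + exact: gap_left_unbounded.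
  + move=> k; have := sub_countable (card_image_le (@ratr R) setT) (countableP _).
    apply: sub_countable; apply: subset_card_le => y [[_ [Ky|//]] /andP[? ?]].
    by have := Ky k; lra.
  + move=> x e Kx e0 c; have [a [b [ab xa bx Kab]]] := off_gaps_near Kx e0.
    apply: (Yunc a b ab); apply: sub_countable c.
    apply: subset_card_le => y [Yy /= yab]; split; last by rewrite /= ltr_norml; lra.
    by split=> //; left; exact: Kab.
Qed.
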